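(* A completable queue implementation has no $\mathsf{VFresh}$ and no $\mathsf{VOrd}$ violations if and only if for every $k\in\mathbb{N}$ and all values $v_1\neq v_2$, the $\mathtt{deq}(v_2)$ thread does not terminate in the program $$\mathit{Prg}(k)=b\gets\mathsf{false};\ \big(\mathtt{deq}(v_2)\ \|\ (\mathtt{enq}(v_1);\,b\gets\mathsf{true})\ \|\ \underbrace{C\,\|\,\cdots\,\|\,C}_{k}\big),$$ $$C=(\mathsf{assume}(b);\,\mathtt{enq}(v_2))\ \sqcup\ \bigsqcup_{x\neq v_2}\mathtt{enq}(x)\ \sqcup\ \bigsqcup_{x\neq v_1}\mathtt{deq}(x).$$
   Context: A queue implementation provides methods $\mathtt{enq}(x)$ and $\mathtt{deq}()$ acting on shared state; its executions are interleavings of atomic thread steps, each inducing a history of invocation and response actions of events; $e\prec_c e'$ iff the response of $e$ precedes the invocation of $e'$ in history $c$. A completion of a history $c$ is a complete history obtained from $c\cdot c'$, with $c'$ consisting only of response actions, by deleting the actions of still-pending events; the implementation is completable if for each induced history $c$ some completion of $c$ is itself an induced history. For a value $v$, $\mathtt{deq}(v)$ is the dequeue method instrumented to behave exactly as $\mathtt{deq}()$ except that it diverges whenever $\mathtt{deq}()$ would return a value other than $v$. $\sqcup$ is nondeterministic choice, $\|$ is parallel composition of threads (each running once) over one shared instance of the implementation in its initial state, $b$ is an auxiliary shared boolean, and $\mathsf{assume}(B)$ blocks unless $B$ holds. Violations of a complete induced history $c$ (writing $\mathtt{enq}(x)$, $\mathtt{deq}(x)$ for an enqueue of $x$ and a dequeue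 returning $x$, values being assumed enqueued at most once): ($\mathsf{VFresh}$) some $x\neq\mathtt{NULL}$ has a dequeue $\mathtt{deq}(x)$ in $c$ and either no $\mathtt{enq}(x)$ in $c$ or $\mathtt{deq}(x)\prec_c\mathtt{enq}(x)$; ($\mathsf{VOrd}$) there are values $x,y$ with $\mathtt{enq}(y)\prec_c\mathtt{enq}(x)$, a dequeue $\mathtt{deq}(x)$ in $c$, and either no dequeue of $y$ in $c$ or $\mathtt{deq}(x)\prec_c\mathtt{deq}(y)$.
   Formalization: The set of values is assumed infinite (for finite value sets the equivalence fails), and deq(v) is read prophetically: it either diverges without effect or is a call of deq() that can still return v, jointly with the other calls in progress. *)

(* Defs.v *)
From HB Require Import structures.
From mathcomp Require Import all_boot.

Set Implicit Arguments.
Unset Strict Implicit.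
Unset Printing Implicit Defensive.

(** * Histories

  [V] is the type of values that can be enqueued.  A dequeue returns an element
  of [option V], where [None] stands for NULL. *)

Inductive label (V : Type) : Type :=
| InvEnq of V            (* invocation of enq(x) *)
| InvDeq                 (* invocation of deq() *)
| ResEnq                 (* response of an enqueue *)
| ResDeq of option V.    (* response of a dequeue, with the value returned *)
Arguments InvDeq {V}.
Arguments ResEnq {V}.

Section LabelEqType.
Variable V : Type.

Definition label_code (l : label V) : option V + option (option V) :=
  match l with
  | InvEnq x => inl (Some x)
  | InvDeq => inl None
  | ResEnq => inr None
  | ResDeq r => inr (Some r)
  end.

Definition label_decode (c : option V + option (option V)) : label V :=
  match c with
  | inl (Some x) => InvEnq x
  | inl None => InvDeq
  | inr None => ResEnq
  | inr (Some r) => ResDeq r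
  end.

Lemma label_codeK : cancel label_code label_decode.
Proof. by case. Qed.

End LabelEqType.

HB.instance Definition _ (V : eqType) :=
  Equality.copy (label V) (can_type (@label_codeK V)).

(* An action is tagged with the event it belongs to; there are no thread
   identifiers, see [queue_impl]. *)
Definition action (V : Type) : Type := (nat * label V)%type.
Definition history (V : Type) : Type := seq (action V).

Definition is_res (V : Type) (l : label V) : bool :=
  match l with ResEnq | ResDeq _ => true | _ => false end.

Section Histories.
Variable V : eqType.
Implicit Types (h : history V) (e : nat).

Definition invoked h e : bool := has (fun a => (a.1 == e) && ~~ is_res a.2) h.
Definition responded h e : bool := has (fun a => (a.1 == e) && is_res a.2) h.
Definition pending h e : bool := invoked h e && ~~ responded h e.
Definition complete h : Prop := forall e, ~~ pending h e.

Definition prec h e e' : Prop :=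
  exists h1 h2 r i,
    [/\ h = h1 ++ h2, is_res r, (e, r) \in h1, ~~ is_res i & (e', i) \in h2].

(* [completable] below only considers completions that are induced, hence
   well formed: a response in [h'] to an event that is not pending in [h], or
   of the wrong kind, is excluded there. *)
Definition completion h hc : Prop :=
  exists h', [/\ all (fun a => is_res a.2) h',
    hc = [seq a <- h ++ h' | ~~ pending (h ++ h') a.1] & complete hc].

Definition is_enq h e (x : V) : Prop := (e, InvEnq x) \in h.

Definition is_deq h e (r : option V) : Prop := (e, ResDeq r) \in h.

Definition enq_once h : Prop :=
  forall x e e', is_enq h e x -> is_enq h e' x -> e = e'.

Definition VFresh h : Prop :=
  exists (x : V) d, is_deq h d (Some x) /\
    ((forall e, ~ is_enq h e x) \/ (exists e, is_enq h e x /\ prec h d e)).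

(* A (faulty) queue may dequeue [y] several times: all these dequeues have to
   come after the dequeue of [x]. *)
Definition VOrd h : Prop :=
  exists (x y : V) ey ex d,
    [/\ is_enq h ey y, is_enq h ex x, prec h ey ex, is_deq h d (Some x) &
        (forall d', ~ is_deq h d' (Some y)) \/
        (forall d', is_deq h d' (Some y) -> prec h d d')].

End Histories.

(** * Queue implementations and their executions *)

(* The code of a method with argument in [A] and result in [R] acting on a
   shared state in [S]: [step s l s' l'] is one (possibly nondeterministic)
   atomic step, and [returns l r] means that the method may return [r] from the
   local state [l]. *)
Record method (S A R : Type) : Type := Method {
  local : Type;
  entry : A -> local;
  step : S -> local -> S -> local -> Prop;
  returns : local -> R -> Prop
}.

(* Methods keep no state that is private to a thread from one call to the next,
   and do not see the identity of the calling thread. *)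
Record queue_impl (V : Type) : Type := QueueImpl {
  shared : Type;
  init : shared;
  enq : method shared V unit;
  deq : method shared unit (option V)
}.

Inductive run (A S : Type) (step : S -> seq A -> S -> Prop) :
    S -> seq A -> S -> Prop :=
| RunNil s : run step s [::] s
| RunStep s l s' h s'' :
    step s l s' -> run step s' h s'' -> run step s (l ++ h) s''.

Section Executions.
Variables (V : eqType) (I : queue_impl V).

Inductive status : Type :=
| Unused
| RunEnq of local (enq I)
| RunDeq of local (deq I)
| Returned.

Record qstate : Type := QState { mem : shared I; evt : nat -> status }.

Definition qinit : qstate := QState (init I) (fun=> Unused).

Definition set_evt (q : qstate) (m : shared I) (e : nat) (st : status) :=
  QState m [eta evt q with e |-> st].

(* The implementation under an arbitrary client, which may call any method at
   any time. *)
Inductive qstep (q : qstate) : seq (action V) -> qstate -> Prop :=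
| QInvEnq e x : evt q e = Unused ->
    qstep q [:: (e, InvEnq x)] (set_evt q (mem q) e (RunEnq (entry (enq I) x)))
| QInvDeq e : evt q e = Unused ->
    qstep q [:: (e, InvDeq)] (set_evt q (mem q) e (RunDeq (entry (deq I) tt)))
| QStepEnq e l m' l' : evt q e = RunEnq l -> step (mem q) l m' l' ->
    qstep q [::] (set_evt q m' e (RunEnq l'))
| QStepDeq e l m' l' : evt q e = RunDeq l -> step (mem q) l m' l' ->
    qstep q [::] (set_evt q m' e (RunDeq l'))
| QResEnq e l : evt q e = RunEnq l -> returns l tt ->
    qstep q [:: (e, ResEnq)] (set_evt q (mem q) e Returned)
| QResDeq e l r : evt q e = RunDeq l -> returns l r ->
    qstep q [:: (e, ResDeq r)] (set_evt q (mem q) e Returned).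

(* The standing assumption that values are enqueued at most once is made here
   and, for the executions of client programs, in [execution]. *)
Definition induced (h : history V) : Prop :=
  enq_once h /\ exists q, run qstep qinit h q.

Definition completable : Prop :=
  forall h, induced h -> exists2 hc, completion h hc & induced hc.

End Executions.

(** * Client programs *)

(* Commands are in prefix form: [CEnq x c] is "enq(x); c". *)
Inductive cmd (V : Type) : Type :=
| Halt
| CEnq of V & cmd V
| CDeq of option V & cmd V     (* the instrumented method deq(v) *)
| CSetB of bool & cmd V        (* b <- v *)
| CAssume of cmd V             (* assume(b) *)
| CChoice (A : Type) of (A -> cmd V).
Arguments Halt {V}.

Definition COr (V : Type) (c1 c2 : cmd V) : cmd V :=
  CChoice (fun i : bool => if i then c1 else c2).

Section Clients.
Variables (V : eqType) (I : queue_impl V).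

Inductive tstate : Type :=
| Ready of cmd V
| InEnq of nat & cmd V                (* in the call with the given event *)
| InDeq of nat & option V & cmd V     (* in a call of deq(v) *)
| Diverged.

Record cstate : Type := CState {
  que : qstate I;
  flag : bool;
  thr : nat -> tstate
}.

Definition set_thr (s : cstate) q b (t : nat) (ts : tstate) : cstate :=
  CState q b [eta thr s with t |-> ts].

Inductive cstep (s : cstate) : history V -> cstate -> Prop :=
| CStepSetB t b c : thr s t = Ready (CSetB b c) ->
    cstep s [::] (set_thr s (que s) b t (Ready c))
| CStepAssume t c : thr s t = Ready (CAssume c) -> flag s ->
    cstep s [::] (set_thr s (que s) (flag s) t (Ready c))
| CStepChoice t A (f : A -> cmd V) a : thr s t = Ready (CChoice f) ->
    cstep s [::] (set_thr s (que s) (flag s) t (Ready (f a)))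
| CStepCallEnq t x c e q' : thr s t = Ready (CEnq x c) ->
    qstep (que s) [:: (e, InvEnq x)] q' ->
    cstep s [:: (e, InvEnq x)] (set_thr s q' (flag s) t (InEnq e c))
| CStepCallDeq t v c e q' : thr s t = Ready (CDeq v c) ->
    qstep (que s) [:: (e, InvDeq)] q' ->
    cstep s [:: (e, InvDeq)] (set_thr s q' (flag s) t (InDeq e v c))
| CStepDiverge t v c : thr s t = Ready (CDeq v c) ->
    cstep s [::] (set_thr s (que s) (flag s) t Diverged)
| CStepMethod q' : qstep (que s) [::] q' ->
    cstep s [::] (CState q' (flag s) (thr s))
| CStepRetEnq t e c q' : thr s t = InEnq e c ->
    qstep (que s) [:: (e, ResEnq)] q' ->
    cstep s [:: (e, ResEnq)] (set_thr s q' (flag s) t (Ready c))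
| CStepRetDeq t e v c q' : thr s t = InDeq e v c ->
    qstep (que s) [:: (e, ResDeq v)] q' ->
    cstep s [:: (e, ResDeq v)] (set_thr s q' (flag s) t (Ready c)).

(* The program  b <- false; (p_0 || ... || p_(n-1)). *)
Definition cinit (p : seq (cmd V)) : cstate :=
  CState (qinit I) false (fun t => Ready (nth Halt p t)).

(* A call of deq(v) either diverges at once ([CStepDiverge]) or behaves exactly
   as a call of deq() that returns v: the calls in progress at the end of an
   execution are such that some further run of the implementation, with
   arbitrary further calls by its environment, lets all of them return the
   prescribed values.  Testing the value only at the return of deq() would not
   do: a deq(v) that has already removed another value from the queue would
   then diverge with a visible effect, that of a dequeue of that other value. *)
Definition execution (p : seq (cmd V)) (h : history V) (s : cstate) : Prop :=
  run cstep (cinit p) h s /\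
  exists h' q',
    [/\ run (@qstep V I) (que s) h' q', enq_once (h ++ h') &
        forall t e v c, thr s t = InDeq e v c -> is_deq h' e v].

Definition may_terminate (p : seq (cmd V)) (t : nat) : Prop :=
  exists h s, execution p h s /\ thr s t = Ready Halt.

End Clients.

Definition C (V : eqType) (v1 v2 : V) : cmd V :=
  COr (CAssume (CEnq v2 Halt))
 (COr (CChoice (fun x : {x : V | x != v2} => CEnq (val x) Halt))
      (CChoice (fun r : {r : option V | r != Some v1} => CDeq (val r) Halt))).

(* The deq(v2) thread is thread 0. *)
Definition Prg (V : eqType) (v1 v2 : V) (k : nat) : seq (cmd V) :=
  [:: CDeq (Some v2) Halt, CEnq v1 (CSetB true Halt) & nseq k (C v1 v2)].

(* Main.v *)
Require Import Defs.
From mathcomp Require Import all_boot.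

(** Left to right: if deq(v2) terminates in Prg(k), complete the history of that
  execution followed by the run that lets the calls in progress return.  Either
  no enq(v2) precedes the response of deq(v2), a VFresh violation, or one does;
  it then comes after assume(b), hence after enq(v1).  No dequeue invoked by the
  client returns v1, so all dequeues of v1 come after deq(v2): a VOrd violation.

  Right to left: cut a violating history just after the response of the
  offending dequeue d of x.  Prg(k), with v2 = x, replays the first part: d runs
  in thread 0 and any event other than enq(v1) in a copy of C.  The second part
  lets all the calls in progress return.  For VOrd, v1 = y: a dequeue of y is
  invoked in the second part only, so the replay needs no deq(v1).  For VFresh,
  v1 is a value that is never dequeued and thread 1 never runs. *)

Set Implicit Arguments.
Unset Strict Implicit.
Unset Printing Implicit Defensive.

(** * Runs of labelled transition systems *)

Section Runs.
Variables (A S : Type) (step : S -> seq A -> S -> Prop).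

Lemma run_step1 s l s' : step s l s' -> run step s l s'.
Proof. by move=> st; rewrite -[l]cats0; apply: RunStep st _; apply: RunNil. Qed.

Lemma run_cat s h s' h' s'' :
  run step s h s' -> run step s' h' s'' -> run step s (h ++ h') s''.
Proof.
by elim=> [//|{}s l s1 {}h s2 st _ IH r]; rewrite -catA; apply: RunStep st (IH r).
Qed.

Lemma run_silent_step s s' l s'' :
  run step s [::] s' -> step s' l s'' -> run step s l s''.
Proof. by move=> r /run_step1; apply: run_cat r. Qed.

Lemma run_step_silent s l s' s'' :
  step s l s' -> step s' [::] s'' -> run step s l s''.
Proof. by move=> st /run_step1 r; rewrite -[l]cats0; apply: RunStep st r. Qed.

Lemma run_invariant (J : seq A -> S -> Prop) :
  (forall h s l s', J h s -> step s l s' -> J (h ++ l) s') ->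
  forall s h s', run step s h s' -> forall h0, J h0 s -> J (h0 ++ h) s'.
Proof.
move=> HJ s h s'; elim=> [{}s h0|{}s l s1 {}h s2 st _ IH h0 J0].
  by rewrite cats0.
by rewrite catA; apply: IH; apply: HJ J0 st.
Qed.

(** A step emits at most one action, so no step straddles the cut of the history. *)
Lemma run_split (size_step : forall s l s', step s l s' -> size l <= 1) s h1 h2 s' :
  run step s (h1 ++ h2) s' ->
  exists2 s1, run step s h1 s1 & run step s1 h2 s'.
Proof.
move Eh: (h1 ++ h2) => h r; elim: r h1 Eh => {s h s'} [s [|//] /= ->|s l s1 h s2 st r IH h1].
  by exists s; apply: RunNil.
case: l st (size_step _ _ _ st) => [|a [|//]] st _.
  move=> /IH [s3 r1 r2]; exists s3 => //; exact: RunStep st r1.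
case: h1 => [/= Eh|b h1 [-> /IH[s3 r1 r2]]].
  by exists s; [apply: RunNil | rewrite Eh; apply: RunStep st r].
by exists s3 => //; apply: RunStep st r1.
Qed.

End Runs.

(** * Histories projected on a single event *)

Section WellFormed.
Variable V : eqType.
Implicit Types (h : history V) (e : nat) (l : label V) (r : option V).

Definition labels h e : seq (label V) := [seq a.2 | a <- h & a.1 == e].

Lemma labels_cat h h' e : labels (h ++ h') e = labels h e ++ labels h' e.
Proof. by rewrite /labels filter_cat map_cat. Qed.

Lemma mem_labels h e l : (l \in labels h e) = ((e, l) \in h).
Proof.
apply/mapP/idP => [[[e' l'] + ->]|H]; last by exists (e, l); rewrite ?mem_filter ?eqxx.
by rewrite mem_filter => /andP[/eqP /= ->].
Qed.

Lemma respondedP h e : reflect (exists2 l, is_res l & (e, l) \in h) (responded h e).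
Proof.
apply: (iffP hasP) => [[[e' l] H /andP[/eqP /= <- R]]|[l R H]].
  by exists l.
by exists (e, l); rewrite //= eqxx.
Qed.

Lemma invokedP h e : reflect (exists2 l, ~~ is_res l & (e, l) \in h) (invoked h e).
Proof.
apply: (iffP hasP) => [[[e' l] H /andP[/eqP /= <- R]]|[l R H]].
  by exists l.
by exists (e, l); rewrite //= eqxx.
Qed.

Definition wf_labels (s : seq (label V)) : bool :=
  match s with
  | [::] | [:: InvEnq _] | [:: InvDeq] | [:: InvEnq _; ResEnq]
  | [:: InvDeq; ResDeq _] => true
  | _ => false
  end.

Definition well_formed h : Prop := forall e, wf_labels (labels h e).

Lemma wf_labelsP s : wf_labels s ->
  [\/ s = [::], s = [:: InvDeq] \/ (exists x, s = [:: InvEnq x]),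
      exists x, s = [:: InvEnq x; ResEnq] |
      exists r, s = [:: InvDeq; ResDeq r]].
Proof.
case: s => [|[x||//|//] [|[//|//||r] [|//]]] // _.
- by constructor 1.
- by constructor 2; right; exists x.
- by constructor 3; exists x.
- by constructor 2; left.
- by constructor 4; exists r.
Qed.

(** An event has at most one invocation and one response, in this order, so two of its actions on
    either side of a cut can only be these. *)
Lemma wf_before h1 h2 e l l' : well_formed (h1 ++ h2) ->
  (e, l) \in h1 -> (e, l') \in h2 -> ~~ is_res l && is_res l'.
Proof.
move=> /(_ e); rewrite labels_cat -!mem_labels.
case: (labels h1 e) => [//|a [|b s1]]; case: (labels h2 e) => [//|c s2] /=.
  by case: a => [x||//|//]; case: c => [//|//||r]; case: s2 => //;
     rewrite !inE => _ /eqP-> /eqP->.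
by case: a b s1 => [x||//|//] [//|//||r] [].
Qed.

Lemma wf_deq h e r : well_formed h -> is_deq h e r ->
  labels h e = [:: InvDeq; ResDeq r].
Proof.
move=> /(_ e) /wf_labelsP; rewrite /is_deq -mem_labels.
by case=> [->|[->|[x ->]]|[x ->]|[r' ->]] //; rewrite !inE //= => /eqP[->].
Qed.

Lemma wf_enq h e x : well_formed h -> is_enq h e x ->
  labels h e = [:: InvEnq x] \/ labels h e = [:: InvEnq x; ResEnq].
Proof.
move=> /(_ e) /wf_labelsP; rewrite /is_enq -mem_labels.
case=> [->|[->|[y ->]]|[y ->]|[r ->]] //; rewrite !inE ?orbF //= => /eqP[->].
  by left.
by right.
Qed.

Lemma wf_complete_deq h e : well_formed h -> complete h -> (e, InvDeq) \in h ->
  exists r, is_deq h e r.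
Proof.
move=> wf /(_ e); rewrite negb_and negbK => comp He.
have [/invokedP[]|/respondedP[l R H]] := orP comp; first by exists InvDeq.
move: (wf e) R He => /wf_labelsP S R.
case: S => [S|[S|[y S]]|[y S]|[r S]]; rewrite -mem_labels in H; rewrite -mem_labels S //.
- by move: H R; rewrite S inE => /eqP->.
- by rewrite /is_deq; exists r; rewrite -mem_labels S !inE eqxx orbT.
Qed.

End WellFormed.

(** * Histories induced by the implementation *)

Section Implementation.
Variables (V : eqType) (I : queue_impl V).
Implicit Types (h : history V) (q : qstate I).

Lemma size_qstep q l q' : qstep q l q' -> size l <= 1.
Proof. by case. Qed.

(** A status does not expose the value enqueued or returned, hence the existentials. *)
Definition status_labels (st : status I) (s : seq (label V)) : Prop :=
  match st with
  | Unused => s = [::]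
  | RunEnq _ => exists x, s = [:: InvEnq x]
  | RunDeq _ => s = [:: InvDeq]
  | Returned => (exists x, s = [:: InvEnq x; ResEnq]) \/
                (exists r, s = [:: InvDeq; ResDeq r])
  end.

Definition tracks h q : Prop := forall e, status_labels (evt q e) (labels h e).

Lemma qstep_tracks h q l q' : tracks h q -> qstep q l q' -> tracks (h ++ l) q'.
Proof.
move=> T st e; have := T e; rewrite labels_cat.
case: st => [e' x|e'|e' l0 m' l'|e' l0 m' l'|e' l0|e' l0 r] Ee;
  rewrite /labels /= ?[e' == e]eq_sym; case: eqP => [->|_] /=;
  rewrite ?cats0 //= Ee /= -/(labels h e').
- by move=> ->; exists x.
- by move=> ->.
- by [].
- by [].
- by move=> _ [x ->]; left; exists x.
- by move=> _ ->; right; exists r.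
Qed.

Lemma run_tracks h q : run (@qstep V I) (qinit I) h q -> tracks h q.
Proof.
move=> r; apply: (run_invariant (J := tracks) _ r (h0 := [::])) => //.
by move=> *; apply: qstep_tracks; eassumption.
Qed.

Lemma induced_wf h : induced I h -> well_formed h.
Proof.
move=> [_ [q /run_tracks T]] e; have := T e.
by case: (evt q e) => /= [->|_ [x ->]|_ ->|[[x ->]|[r ->]]].
Qed.

Lemma crun_qrun (s s' : cstate I) h :
  run (@cstep V I) s h s' -> run (@qstep V I) (que s) h (que s').
Proof.
elim=> {s h s'} [s|s l s1 h s2 st _]; first exact: RunNil.
by case: st => * //; apply: RunStep; eassumption.
Qed.

End Implementation.

(** * An invariant of the executions of Prg(k) *)

Section Invariant.
Variables (V : eqType) (I : queue_impl V) (v1 v2 : V).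
Implicit Types (h : history V) (t : nat) (c : cmd V).

Definition enq_done h (x : V) : Prop :=
  exists e, is_enq h e x /\ (e, ResEnq) \in h.

Lemma enq_doneS h h' x : {subset h <= h'} -> enq_done h x -> enq_done h' x.
Proof. by move=> sub [e [? ?]]; exists e; split; apply: sub. Qed.

(* A weakest precondition, relative to the history [h] at which thread [t] is
   about to run [c]; quantifying over larger histories makes it stable under
   the steps of the other threads. *)
Fixpoint safe t h c : Prop :=
  match c with
  | Halt => t = 0 -> exists d, is_deq h d (Some v2)
  | CEnq x c' => (x = v2 -> enq_done h v1) /\
      forall h', {subset h <= h'} -> (x = v1 -> enq_done h' v1) -> safe t h' c'
  | CDeq r c' => r <> Some v1 /\
      forall h', {subset h <= h'} -> (exists d, is_deq h' d r) -> safe t h' c'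
  | CSetB b c' => (b -> enq_done h v1) /\ safe t h c'
  | CAssume c' => forall h', {subset h <= h'} -> enq_done h' v1 -> safe t h' c'
  | CChoice A f => forall a, safe t h (f a)
  end.

Lemma safeS t h h' c : {subset h <= h'} -> safe t h c -> safe t h' c.
Proof.
move=> sub; elim: c => [|x c IH|r c IH|b c IH|c IH|A f IH] /=.
- by move=> H /H[d Hd]; exists d; apply: sub.
- case=> H1 H2; split=> [/H1|h2 sub2]; first exact: enq_doneS.
  by apply: H2 => a /sub /sub2.
- by case=> H1 H2; split=> // h2 sub2; apply: H2 => a /sub /sub2.
- by case=> H1 H2; split=> [/H1|]; [exact: enq_doneS | apply: IH].
- by move=> H h2 sub2; apply: H => a /sub /sub2.
- by move=> H a; apply: IH.
Qed.

(** The test of [b] supplies the completed enq(v1) that enq(v2) demands, and no thread calls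
    deq(v1): thread 0 because [v1 <> v2], the copies of C by the restriction on their choice. *)
Lemma safe_Prg k t : v1 <> v2 -> safe t [::] (nth Halt (Prg v1 v2 k) t).
Proof.
move=> neq; case: t => [|[|t]] /=.
- by split=> [[Ev]|h _ [d Hd] _]; [apply: neq | exists d].
- by split=> [/neq|h _ H] //; split=> // _; apply: H.
rewrite nth_nseq; case: ifP => // _ [] /=; first by move=> h _ H; split.
case=> [[x /= /eqP xv2]|[r /= /eqP rv1]]; split=> //.
Qed.

(** The state [InEnq] does not store its value, which is recovered from the history. The
    continuation of a call in progress only has to be safe once the call has returned. *)
Definition tsafe t h (ts : tstate V) : Prop :=
  match ts with
  | Ready c => safe t h c
  | InEnq e c => exists2 x, is_enq h e x &
      forall h', {subset h <= h'} -> (x = v1 -> enq_done h' v1) -> safe t h' c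
  | InDeq e r c =>
      forall h', {subset h <= h'} -> is_deq h' e r -> safe t h' c
  | Diverged => True
  end.

Lemma tsafeS t h h' ts : {subset h <= h'} -> tsafe t h ts -> tsafe t h' ts.
Proof.
move=> sub; case: ts => [c|e c|e r c|] //=; first exact: safeS.
  case=> x Hx H; exists x; first exact: sub.
  by move=> h2 sub2; apply: H => a /sub /sub2.
by move=> H h2 sub2; apply: H => a /sub /sub2.
Qed.

Definition enq_ordered h : Prop :=
  forall e, is_enq h e v2 -> exists2 ey, is_enq h ey v1 & prec h ey e.

(** The second alternative covers calls still in progress: their prescribed value is returned only
    in the further run required by [execution], outside [h]. *)
Definition deq_recorded h (s : cstate I) : Prop :=
  forall e, (e, InvDeq) \in h -> exists2 r, r <> Some v1 &
    is_deq h e r \/ exists t c, thr s t = InDeq e r c.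

Definition client_inv h (s : cstate I) : Prop :=
  [/\ forall t, tsafe t h (thr s t), flag s -> enq_done h v1,
      enq_ordered h & deq_recorded h s].

Lemma prec_catl h h' e e' : prec h e e' -> prec (h ++ h') e e'.
Proof.
case=> h1 [h2 [r [i [-> R H1 NI H2]]]]; exists h1, (h2 ++ h'), r, i.
by rewrite catA; split=> //; rewrite mem_cat H2.
Qed.

(** Only the invocation of an enq(v2) can endanger [enq_ordered], and only the invocation or return
    of a dequeue can affect [deq_recorded]; [HE'] and [HD'] reduce the two clauses to these
    steps. *)
Lemma cstep_client_inv h s l s' :
  client_inv h s -> cstep s l s' -> client_inv (h ++ l) s'.
Proof.
move=> [HT HF HE HD] st.
have sub a : a \in h -> a \in h ++ l by rewrite mem_cat => ->.
have HF' : flag s -> enq_done (h ++ l) v1 by move=> /HF; apply: enq_doneS.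
have HE' : (forall e, (e, InvEnq v2) \in l -> enq_done h v1) -> enq_ordered (h ++ l).
  move=> Hl e; rewrite /is_enq mem_cat => /orP[/HE[ey H1 H2]|Hel].
    by exists ey; [apply: sub | apply: prec_catl].
  (* The new invocation ends the history, so the cut between [h] and [l] shows that the completed
     enq(v1) precedes it. *)
  have [ey [H1 H2]] := Hl _ Hel; exists ey; first exact: sub.
  by exists h, l, ResEnq, (InvEnq v2); split.
have HD' : (forall e, (e, InvDeq) \in l -> exists2 r, r <> Some v1 &
              exists t c, thr s' t = InDeq e r c) ->
    (forall t e r c, thr s t = InDeq e r c ->
       thr s' t = InDeq e r c \/ (e, ResDeq r) \in l) -> deq_recorded (h ++ l) s'.
  move=> H1 H2 e; rewrite mem_cat => /orP[/HD[r Nr Hr]|/H1[r Nr Hr]]; last first.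
    by exists r => //; right.
  exists r => //; case: Hr => [/sub|[t [c /H2[|Hl]]]]; first by left.
    by right; exists t, c.
  by left; rewrite /is_deq mem_cat Hl orbT.
have upd t ts : tsafe t (h ++ l) ts ->
    forall t', tsafe t' (h ++ l) (if t' == t then ts else thr s t').
  by move=> Hts t'; case: eqP => [->|_] //; apply: tsafeS (HT t').
have keep t ts0 ts : thr s t = ts0 -> (forall e r c, ts0 <> InDeq e r c) ->
    forall t' e r c, thr s t' = InDeq e r c ->
      (if t' == t then ts else thr s t') = InDeq e r c \/ (e, ResDeq r) \in l.
  by move=> E N t' e r c E'; case: eqP => [tt|_]; [case: (N e r c); rewrite -E -tt | left].
case: st sub HF' HE' HD' upd keep => 
  [t b c E|t c E fl|t A f a E|t x c e q' E _|t r c e q' E _|t r c E|q' _|t e c q' E _|t e r c q' E _]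
  sub HF' HE' HD' upd keep; have := HT; rewrite /client_inv /=.
- move=> /(_ t); rewrite E => -[Hb Hc]; split.
  + by apply: upd; apply: safeS Hc.
  + by move/Hb; apply: enq_doneS.
  + exact: HE'.
  + by apply: HD' => //=; apply: keep E _.
- move=> /(_ t); rewrite E => Hc; split=> //.
  + by apply: upd; apply: Hc => //; apply: HF'.
  + exact: HE'.
  + by apply: HD' => //=; apply: keep E _.
- move=> /(_ t); rewrite E => Hc; split=> //.
  + by apply: upd; apply: safeS (Hc a).
  + exact: HE'.
  + by apply: HD' => //=; apply: keep E _.
- move=> /(_ t); rewrite E => -[H1 H2]; split=> //.
  + apply: upd => /=; exists x; first by rewrite /is_enq mem_cat inE eqxx orbT.
    by move=> h' sub'; apply: H2 => a /sub /sub'.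
  + by apply: HE' => e'; rewrite inE => /eqP[_ /esym].
  + by apply: HD' => /= [e'|]; [rewrite inE => /eqP | apply: keep E _].
- move=> /(_ t); rewrite E => -[H1 H2]; split=> //.
  + by apply: upd => /= h' sub' Hd; apply: H2 => [a /sub /sub'|] //; exists e.
  + by apply: HE' => e'; rewrite inE => /eqP.
  + apply: HD' => //=; last exact: keep E _.
    move=> e'; rewrite inE => /eqP[->]; exists r => //; exists t, c.
    by rewrite eqxx.
- move=> _; split=> //; [exact: upd | exact: HE' |].
  by apply: HD' => //=; apply: keep E _.
- move=> _; split=> //; [| exact: HE' |].
  + by move=> t; apply: tsafeS (HT t).
  + by apply: HD' => //= t e r c ->; left.
- move=> /(_ t); rewrite E => -[x Hx H]; split=> //.
  + apply: upd => /=; apply: H => // Ex; exists e; rewrite -Ex; split; first exact: sub.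
    by rewrite mem_cat inE eqxx orbT.
  + by apply: HE' => e'; rewrite inE => /eqP.
  + by apply: HD' => /= [e'|]; [rewrite inE => /eqP | apply: keep E _].
- move=> /(_ t); rewrite E => H; split=> //.
  + by apply: upd; apply: H => //; rewrite /is_deq mem_cat inE eqxx orbT.
  + by apply: HE' => e'; rewrite inE => /eqP.
  + apply: HD' => /= [e'|t' e' r' c']; first by rewrite inE => /eqP.
    case: eqP => [->|_]; last by left.
    by rewrite E => -[-> -> _]; right; rewrite inE.
Qed.

Lemma run_client_inv k h s : v1 <> v2 ->
  run (@cstep V I) (cinit I (Prg v1 v2 k)) h s -> client_inv h s.
Proof.
move=> neq r; apply: (run_invariant (J := client_inv) _ r (h0 := [::])).
  by move=> *; apply: cstep_client_inv; eassumption.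
by split=> // t; apply: safe_Prg.
Qed.

End Invariant.

(** * From a terminating deq(v2) to a violation *)

Section Soundness.
Variables (V : eqType) (I : queue_impl V) (v1 v2 : V) (k : nat).

Lemma terminates_violation : completable I -> v1 <> v2 ->
  may_terminate I (Prg v1 v2 k) 0 ->
  exists hc, [/\ induced I hc, complete hc & VFresh hc \/ VOrd hc].
Proof.
move=> compl neq [h [s [[r [h' [q' [r' once retq]]]] term]]].
have [HT _ HE HD] := run_client_inv neq r.
have [d Hd] : exists d, is_deq h d (Some v2) by have := HT 0; rewrite term; apply.
have ind : induced I (h ++ h').
  by split=> //; exists q'; apply: run_cat r'; apply: crun_qrun r.
have [hc [h2 [/allP /= res2 Ehc chc] indc]] := compl _ ind.
exists hc; split=> //; have wf := induced_wf indc.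
(* The completion keeps the actions satisfying [np] in three consecutive segments: the client
   history [h], the run [h'] in which the calls in progress return, and the added responses [h2].
   The cases below depend on the segment in which an invocation lies. *)
pose np (a : action V) := ~~ pending ((h ++ h') ++ h2) a.1.
have Ec : hc = filter np h ++ filter np h' ++ filter np h2.
  by rewrite Ehc !filter_cat catA.
(* An event with a response in [h ++ h'] is not pending, so none of its actions is deleted. *)
have npR e l l' : is_res l -> (e, l) \in h ++ h' -> np (e, l').
  move=> R H; rewrite /np /pending negb_and negbK; apply/orP; right.
  by apply/respondedP; exists l => //; rewrite mem_cat H.
have in_hc a : np a -> a \in h ++ h' -> a \in hc.
  by move=> na Ha; rewrite Ec catA mem_cat -filter_cat mem_filter na Ha.
have kept e r0 : is_deq (h ++ h') e r0 -> is_deq hc e r0.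
  by move=> H; apply: in_hc => //; apply: npR H.
have Hdc : is_deq hc d (Some v2) by apply: kept; rewrite /is_deq mem_cat Hd.
have Hdf : (d, ResDeq (Some v2)) \in filter np h.
  by rewrite mem_filter Hd andbT; apply: (@npR _ (ResDeq (Some v2))); rewrite // mem_cat Hd.
(* The response of [d] lies in [h], so the cut after [h] witnesses the precedence. *)
have after e i : ~~ is_res i -> (e, i) \in filter np h' -> prec hc d e.
  move=> Ni H; exists (filter np h), (filter np h' ++ filter np h2), (ResDeq (Some v2)), i.
  by split=> //; rewrite mem_cat H.
have not_res e i : ~~ is_res i -> (e, i) \in filter np h2 -> False.
  by rewrite mem_filter => Ni /andP[_ /res2 /=]; apply/negP.
case: (boolP (has (fun a => a.2 == InvEnq v2) hc)) => [/hasP[[e l] He /eqP /= El]|/hasPn no].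
  2: { left; exists v2, d; split=> //; left=> e He; by have := no _ He; rewrite eqxx. }
rewrite {l}El in He; have := He; rewrite {1}Ec !mem_cat.
case/or3P=> [Heh|Heh'|He2]; last by case: (not_res e _ _ He2).
  2: { by left; exists v2, d; split=> //; right; exists e; split=> //; apply: (after e (InvEnq v2) isT Heh'). }
have nE l : np (e, l) by move: Heh; rewrite mem_filter => /andP[].
have [ey Hey [h3 [h4 [r1 [i [E34 R H3 Ni H4]]]]]] : exists2 ey, is_enq h ey v1 & prec h ey e.
  by apply: HE; move: Heh; rewrite mem_filter => /andP[].
have npey l : np (ey, l) by apply: npR R _; rewrite E34 !mem_cat H3.
right; exists v2, v1, ey, e, d; split=> //.
- by apply: in_hc; rewrite // mem_cat Hey.
- exists (filter np h3), (filter np h4 ++ filter np h' ++ filter np h2), r1, i.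
  rewrite Ec E34 filter_cat -catA; split=> //; first by rewrite mem_filter H3 npey.
  by rewrite mem_cat mem_filter H4 andbT nE.
right=> d' Hd'; have S := wf_deq wf Hd'.
have : (d', InvDeq) \in hc by rewrite -mem_labels S inE eqxx.
rewrite {1}Ec !mem_cat => /or3P[H|H|H]; last by case: (not_res d' _ _ H).
  2: { exact: (after d' InvDeq isT H). }
(* A dequeue invoked in [h] returns its prescribed value, different from v1, either in [h] or, by
   [retq], in [h']; since an event has a single response, this contradicts [Hd']. *)
move: H; rewrite mem_filter => /andP[_ /HD[r0 Nr0 Hr0]]; case: Nr0.
have /kept H0 : is_deq (h ++ h') d' r0.
  rewrite /is_deq mem_cat; case: Hr0 => [->//|[t [c /retq Hq]]].
  by rewrite Hq orbT.
by move: H0; rewrite /is_deq -mem_labels S !inE /= => /eqP[].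
Qed.

End Soundness.

(** * Replaying a history of the implementation in Prg(k) *)

Section Simulation.
Variables (V : eqType) (I : queue_impl V) (v1 v2 : V) (k d ey : nat).
Variable ret : nat -> option V.
Hypotheses (d_ey : d != ey) (ret_d : ret d = Some v2).

(* The thread of [Prg v1 v2 k] that replays event [e]; [d] is the dequeue of
   [v2] and [ey] the enqueue of [v1], or an unused event if there is none. *)
Definition thread e : nat := if e == d then 0 else if e == ey then 1 else e.+2.

Lemma thread_inj : injective thread.
Proof.
move=> e e'; rewrite /thread.
case: (e =P d) => [->|_]; case: (e' =P d) => [->|_] //; try by case: ifP.
by case: (e =P ey) => [->|_]; case: (e' =P ey) => [->|_] // [].
Qed.

(** Event [e] is replayed by copy number [e] of C unless it is [d] or [ey], hence the bound [k]. The
    response of [ey] in [h] stands for [b] being true. *)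
Definition playable (h : history V) (a : action V) : Prop :=
  a.1 < k /\
  match a.2 with
  | InvEnq x => [/\ a.1 <> d, a.1 = ey -> x = v1 & x = v2 -> (ey, ResEnq) \in h]
  | InvDeq => a.1 <> ey /\ ret a.1 <> Some v1
  | ResEnq => True
  | ResDeq r => r = ret a.1
  end.

Definition event_state e (st : status I) : tstate V :=
  match st with
  | Unused => Ready (nth Halt (Prg v1 v2 k) (thread e))
  | RunEnq _ => InEnq e (if e == ey then CSetB true Halt else Halt)
  | RunDeq _ => InDeq e (ret e) Halt
  | Returned => Ready Halt
  end.

(** The third clause rules out dequeues in progress elsewhere than in the thread of their event; it
    is there because [execution] speaks of all threads. *)
Definition simulates (h : history V) (q : qstate I) (s : cstate I) : Prop :=
  [/\ que s = q, forall e, thr s (thread e) = event_state e (evt q e),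
      forall t e r c, thr s t = InDeq e r c -> t = thread e
    & (ey, ResEnq) \in h -> flag s].

(** The choices and the test of [b] are resolved silently just before the invocation, so that
    [assume] sees the flag at that moment. *)
Definition reaches t (b : bool) (c c' : cmd V) : Prop :=
  forall s : cstate I, thr s t = Ready c -> flag s = b ->
  exists s', [/\ run (@cstep V I) s [::] s', que s' = que s, flag s' = b &
    forall t', thr s' t' = if t' == t then Ready c' else thr s t'].

Lemma reaches_refl t (b : bool) c : reaches t b c c.
Proof.
by move=> s E Eb; exists s; split=> // [|t']; [apply: RunNil | case: eqP => [->|]].
Qed.

Lemma reaches_silent t (b : bool) c c1 c' :
  (forall s : cstate I, thr s t = Ready c -> flag s = b ->
     cstep s [::] (set_thr s (que s) (flag s) t (Ready c1))) ->
  reaches t b c1 c' -> reaches t b c c'.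
Proof.
move=> st H s E Eb.
have [||s' [r' Eq Ef Et]] := H (set_thr s (que s) (flag s) t (Ready c1)) => //=.
  by rewrite eqxx.
exists s'; split=> // [|t']; first exact: RunStep (st s E Eb) r'.
by rewrite Et /=; case: eqP.
Qed.

Lemma reaches_choice t (b : bool) A (f : A -> cmd V) a c' :
  reaches t b (f a) c' -> reaches t b (CChoice f) c'.
Proof. by apply: reaches_silent => s E _; apply: CStepChoice E. Qed.

Lemma reaches_assume t c c' : reaches t true c c' -> reaches t true (CAssume c) c'.
Proof. by apply: reaches_silent => s E Eb; apply: CStepAssume E Eb. Qed.

Lemma reaches_enq t (b : bool) x : (x = v2 -> b) -> reaches t b (C v1 v2) (CEnq x Halt).
Proof.
move=> Hx; have [Ex|/eqP nx] := x =P v2.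
  have -> : b = true by apply: Hx.
  rewrite Ex; apply: (@reaches_choice _ _ _ _ true).
  exact/reaches_assume/reaches_refl.
apply: (@reaches_choice _ _ _ _ false); apply: (@reaches_choice _ _ _ _ true).
apply: (@reaches_choice _ _ _ _ (exist _ x nx)); exact: reaches_refl.
Qed.

Lemma reaches_deq t (b : bool) r : r <> Some v1 -> reaches t b (C v1 v2) (CDeq r Halt).
Proof.
move=> /eqP nr.
apply: (@reaches_choice _ _ _ _ false); apply: (@reaches_choice _ _ _ _ false).
apply: (@reaches_choice _ _ _ _ (exist _ r nr)); exact: reaches_refl.
Qed.

Lemma nth_Prg_other e : e < k -> e <> d -> e <> ey ->
  nth Halt (Prg v1 v2 k) (thread e) = C v1 v2.
Proof. by rewrite /thread => lt /eqP/negPf-> /eqP/negPf->; rewrite /= nth_nseq lt. Qed.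

Lemma reaches_call_enq h e x (b : bool) : playable h (e, InvEnq x) ->
  ((ey, ResEnq) \in h -> b) ->
  reaches (thread e) b (nth Halt (Prg v1 v2 k) (thread e))
    (CEnq x (if e == ey then CSetB true Halt else Halt)).
Proof.
move=> [/= lt [nd Ex Hx] Hb]; case: (e =P ey) => [E|ne].
  rewrite E /thread eqxx eq_sym (negPf d_ey) /= Ex //; exact: reaches_refl.
by rewrite nth_Prg_other //; apply: reaches_enq => /Hx.
Qed.

Lemma reaches_call_deq h e (b : bool) : playable h (e, InvDeq) ->
  reaches (thread e) b (nth Halt (Prg v1 v2 k) (thread e)) (CDeq (ret e) Halt).
Proof.
move=> [/= lt [ne nr]]; case: (e =P d) => [->|nd].
  by rewrite /thread eqxx ret_d; apply: reaches_refl.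
by rewrite nth_Prg_other //; apply: reaches_deq.
Qed.

(** Before an invocation the thread runs silently up to its call. Right after the response of [ey],
    thread 1 sets [b], so the flag is up when a later enq(v2) is replayed. Steps inside a method are
    copied by [CStepMethod]. *)
Lemma simulates_step h q l q' s : simulates h q s -> qstep q l q' ->
  (forall a : action V, a \in l -> playable h a) ->
  exists2 s', run (@cstep V I) s l s' & simulates (h ++ l) q' s'.
Proof.
move=> [Eq HT HI HF] st Hl.
(* Moving the thread of [e] to the state matching its new status restores the simulation, as
   [thread] is injective. *)
have settle (e : nat) st0 (m : shared I) (s0 : cstate I) (b : bool) :
    (forall t, t <> thread e -> thr s0 t = thr s t) ->
    ((ey, ResEnq) \in h ++ l -> b) ->
    simulates (h ++ l) (set_evt q m e st0)
      (set_thr s0 (set_evt q m e st0) b (thread e) (event_state e st0)).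
  move=> Et Eb; split=> // [e'|t e' r c] /=.
    rewrite (inj_eq thread_inj); case: (e' =P e) => [->|ne] //.
    by rewrite Et // => /thread_inj.
  case: (t =P thread e) => [->|ne]; last by rewrite Et //; apply: HI.
  by case: st0 => [|m0|m0|] //= [->].
have silent (e : nat) st0 (m : shared I) :
    event_state e st0 = event_state e (evt q e) -> l = [::] ->
    simulates (h ++ l) (set_evt q m e st0) (CState (set_evt q m e st0) (flag s) (thr s)).
  by move=> Est ->; rewrite cats0; split=> //= e'; rewrite HT; case: eqP => [->|].
case: st Hl settle silent => [e x Ee|e Ee|e m0 m' l' Ee stp|e m0 m' l' Ee stp|e m0 Ee rt|e m0 r Ee rt]
  Hl settle silent; have := HT e; rewrite Ee /= => Et.
- have /Hl pl : (e, InvEnq x) \in [:: (e, InvEnq x)] by rewrite inE.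
  have [s1 [r1 Eq1 Ef1 Et1]] := reaches_call_enq pl HF Et erefl.
  have Eq' : que s1 = q by rewrite Eq1.
  eexists.
    apply: run_silent_step r1 _.
    apply: (CStepCallEnq (t := thread e)); first by rewrite Et1 eqxx.
    by rewrite Eq'; apply: QInvEnq.
  apply: settle => [t /eqP/negPf nt|]; first by rewrite Et1 nt.
  by rewrite Ef1 mem_cat => /orP[/HF //|]; rewrite inE => /eqP.
- have /Hl pl : (e, InvDeq) \in [:: (e, @InvDeq V)] by rewrite inE.
  have [s1 [r1 Eq1 Ef1 Et1]] := reaches_call_deq (b := flag s) pl Et erefl.
  have Eq' : que s1 = q by rewrite Eq1.
  eexists.
    apply: run_silent_step r1 _.
    apply: (CStepCallDeq (t := thread e)); first by rewrite Et1 eqxx.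
    by rewrite Eq'; apply: QInvDeq.
  apply: settle => [t /eqP/negPf nt|]; first by rewrite Et1 nt.
  by rewrite Ef1 mem_cat => /orP[/HF //|]; rewrite inE => /eqP.
- eexists; last by apply: silent; rewrite ?Ee.
  by apply/run_step1/CStepMethod; rewrite Eq; apply: QStepEnq Ee stp.
- eexists; last by apply: silent; rewrite ?Ee.
  by apply/run_step1/CStepMethod; rewrite Eq; apply: QStepDeq Ee stp.
- have st q1 : q1 = set_evt q (Defs.mem q) e (Returned I) ->
    cstep s [:: (e, ResEnq)] (set_thr s q1 (flag s) (thread e)
      (Ready (if e == ey then CSetB true Halt else Halt))).
    by move=> ->; apply: CStepRetEnq Et _; rewrite Eq; apply: QResEnq Ee rt.
  case: (e =P ey) st => [E|ne] st; last first.
    eexists; first exact: run_step1 (st _ erefl).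
    apply: settle => // ; rewrite mem_cat => /orP[/HF //|]; rewrite inE => /eqP[E].
    by case: ne.
  eexists.
    apply: run_step_silent (st _ erefl) _.
    by apply: (CStepSetB (t := thread e)); rewrite /= eqxx.
  by apply: settle => // t /eqP/negPf /= ->.
- have /Hl [/= _ Er] : (e, ResDeq r) \in [:: (e, ResDeq r)] by rewrite inE.
  eexists.
    apply: run_step1; apply: CStepRetDeq (_ : thr s (thread e) = _) _.
      by rewrite Er; exact: Et.
    by rewrite Eq; apply: QResDeq Ee rt.
  by apply: settle => //; rewrite mem_cat => /orP[/HF //|]; rewrite inE => /eqP.
Qed.

Definition all_playable (h : history V) : Prop :=
  forall h1 a h2, h = h1 ++ a :: h2 -> playable h1 a.

Lemma simulates_run h q : run (@qstep V I) (qinit I) h q -> all_playable h ->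
  exists2 s, run (@cstep V I) (cinit I (Prg v1 v2 k)) h s & simulates h q s.
Proof.
(* Playability is a premise of the invariant: it is known of the whole history and passes to
   prefixes. *)
move=> r; pose J h q := all_playable h ->
  exists2 s, run (@cstep V I) (cinit I (Prg v1 v2 k)) h s & simulates h q s.
apply: (run_invariant (J := J) _ r (h0 := [::])); last first.
  move=> _; exists (cinit I (Prg v1 v2 k)); first exact: RunNil.
  by split.
move=> {r q}h q l q' IH st pl.
have [|s rs sim] := IH; first by move=> h1 a h2 E; apply: (pl h1 a (h2 ++ l)); rewrite E -catA.
have [|s' rs' sim'] := simulates_step sim st; last first.
  by exists s' => //; apply: run_cat rs rs'.
move=> a; case: l st pl => [|b [|c l]] st pl; rewrite ?inE //; last by have := size_qstep st.
by move=> /eqP->; apply: (pl h b [::]).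
Qed.

End Simulation.

(** * From a violation to a terminating deq(v2) *)

Section Completeness.
Variables (V : eqType) (I : queue_impl V).
Implicit Types (h c : history V).

(* The junk value [None] is returned on events that are not dequeues with a
   response. *)
Definition response c e : option V :=
  if labels c e is [:: _; ResDeq r] then r else None.

Lemma response_deq c e r : well_formed c -> is_deq c e r -> response c e = r.
Proof. by move=> wf H; rewrite /response (wf_deq wf H). Qed.

Lemma deq_response c e : well_formed c -> complete c -> (e, InvDeq) \in c ->
  is_deq c e (response c e).
Proof.
by move=> wf comp /(wf_complete_deq wf comp)[r Hr]; rewrite (response_deq wf Hr).
Qed.

(** The bound serves twice: as the number of copies of C, and as an event that does not occur. *)
Lemma event_bound c : exists k, forall a, a \in c -> a.1 < k.
Proof.
exists (\max_(a <- c) a.1).+1 => a Ha; rewrite ltnS.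
exact: (leq_bigmax_seq (F := fun a : action V => a.1) (P := predT)) Ha isT.
Qed.

Lemma invoked_before_response c1 c2 d r : well_formed (c1 ++ (d, ResDeq r) :: c2) ->
  (d, InvDeq) \in c1.
Proof.
move=> wf; have Hd : is_deq (c1 ++ (d, ResDeq r) :: c2) d r.
  by rewrite /is_deq mem_cat inE eqxx orbT.
have : (d, InvDeq) \in c1 ++ (d, ResDeq r) :: c2.
  by rewrite -mem_labels (wf_deq wf Hd) inE eqxx.
rewrite mem_cat inE => /or3P[//|/eqP//|H].
have := @wf_before _ (rcons c1 (d, ResDeq r)) c2 d (ResDeq r) InvDeq.
by rewrite cat_rcons mem_rcons inE eqxx => /(_ wf isT H).
Qed.

(** Both kinds of violation reduce to this statement, in which [ey] may be an event that does not
    occur. Completeness of [c] gives every dequeue a response to prescribe. *)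
Lemma terminates c1 c2 d ey (v1 v2 : V) :
  let c := c1 ++ (d, ResDeq (Some v2)) :: c2 in
  induced I c -> complete c ->
  (forall l, (ey, l) \in c1 -> l = InvEnq v1 \/ l = ResEnq) ->
  (forall g1 e g2, c1 = g1 ++ (e, InvEnq v2) :: g2 -> (ey, ResEnq) \in g1) ->
  (forall e, (e, InvDeq) \in c1 -> ~ is_deq c e (Some v1)) ->
  exists k, may_terminate I (Prg v1 v2 k) 0.
Proof.
move=> c indc comp Hey Hv2 Hdeq.
have wf := induced_wf indc; have [once [q r]] := indc.
have [k Hk] := event_bound c; exists k.
have Hd : is_deq c d (Some v2) by rewrite /is_deq mem_cat inE eqxx orbT.
have Hdi : (d, InvDeq) \in c1 := invoked_before_response wf.
have d_ey : d != ey by apply/eqP => E; have [] := Hey InvDeq; rewrite -?E.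
pose ret := response c.
have ret_d : ret d = Some v2 by apply: response_deq.
pose h := rcons c1 (d, ResDeq (Some v2)).
have Ec : c = h ++ c2 by rewrite /h cat_rcons.
have sub a : a \in c1 -> a \in c by rewrite mem_cat => ->.
have pl : all_playable v1 v2 k d ey ret h.
  move=> h1 [e l] h2 E; split.
    by apply: Hk; rewrite Ec E !mem_cat inE eqxx orbT.
  (* The last action of [h] is the response of [d]; any other lies in [c1], where the hypotheses
     apply. *)
  case: (lastP h2) E => [|h3 b].
    by rewrite cats1 => /rcons_inj[_ <- <-] /=.
  rewrite -rcons_cons -rcons_cat => /rcons_inj[E _].
  have He : (e, l) \in c1 by rewrite E mem_cat inE eqxx orbT.
  case: l E He => [x||//|r0] E He /=.
  - split=> [Ed|Ee|Ex].
    + have := wf_enq wf (sub _ He : is_enq c e x).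
      by rewrite Ed (wf_deq wf Hd) => -[].
    + by move: He; rewrite Ee => /Hey[[]|].
    + by rewrite Ex in E; apply: Hv2 E.
  - split=> [Ee|Er]; first by move: He; rewrite Ee => /Hey[].
    by apply: (Hdeq e He); rewrite -Er; apply: deq_response => //; apply: sub.
  - by rewrite -(response_deq wf (sub _ He)).
move: r; rewrite Ec => /(run_split (@size_qstep _ I)) [q1 r1 r2].
have [s rs [Eq HT HI _]] := simulates_run d_ey ret_d r1 pl.
have tr := run_tracks r1.
exists h, s; split.
  split=> //; exists c2, q; split; rewrite -?Ec ?Eq //.
  move=> t e v c0 E; have Et := HI _ _ _ _ E; move: E; rewrite Et HT.
  have := tr e; case Est: (evt q1 e) => [|m|m|] //= El [<- _].
  (* A dequeue in progress after [h] has a response in [c] but only its invocation in [h], so it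
     responds in [c2]. *)
  have He : (e, InvDeq) \in h by rewrite -mem_labels El inE.
  have : is_deq c e (ret e) by apply: deq_response => //; rewrite Ec mem_cat He.
  by rewrite {1}/is_deq Ec mem_cat -mem_labels El inE.
have Td : thread d ey d = 0 by rewrite /thread eqxx.
rewrite -Td HT; have := tr d.
have : ResDeq (Some v2) \in labels h d by rewrite mem_labels mem_rcons inE eqxx.
by case: (evt q1 d) => [|m|m|] //= + E; [rewrite E|case: E => x -> | rewrite E].
Qed.

(** If the cut witnessing the precedence came after the response [r] of [d], then [e] would be
    invoked on both sides of it; otherwise [d] would respond on both sides. *)
Lemma prec_not_before c c1 c2 d r e l : well_formed c -> c = c1 ++ (d, r) :: c2 ->
  is_res r -> ~~ is_res l -> (e, l) \in c1 -> ~ prec c d e.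
Proof.
move=> wf Ec R Nl He [h1 [h2 [r' [i [E R' H1 Ni H2]]]]].
have [lt|ge] := ltnP (size c1) (size h1).
  have Hl : (e, l) \in h1.
    have <- : take (size h1) c = h1 by rewrite E take_size_cat.
    by rewrite Ec take_cat ltnNge (ltnW lt) /= mem_cat He.
  by have := @wf_before _ h1 h2 e l i; rewrite -E => /(_ wf Hl H2); rewrite (negPf Ni) andbF.
have Hd : (d, r) \in h2.
  have <- : drop (size h1) c = h2 by rewrite E drop_size_cat.
  rewrite Ec drop_cat; case: ltnP => [_|ge']; first by rewrite mem_cat inE eqxx orbT.
  have -> : size h1 - size c1 = 0 by apply/eqP; rewrite subn_eq0.
  by rewrite drop0 inE eqxx.
by have := @wf_before _ h1 h2 d r' r; rewrite -E R' => /(_ wf H1 Hd).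
Qed.

(** The cut witnessing the precedence cannot come after the given invocation of [e'], or [e'] would
    be invoked on both sides of it; so what precedes the cut lies within [g1]. *)
Lemma prec_response c g1 g2 e e' l : well_formed c ->
  c = g1 ++ (e', l) :: g2 -> ~~ is_res l -> prec c e e' ->
  exists2 r, is_res r & (e, r) \in g1.
Proof.
move=> wf Ec Nl [h1 [h2 [r [i [E R H1 Ni H2]]]]]; exists r => //.
have [le|gt] := leqP (size h1) (size g1).
  have <- : take (size g1) c = g1 by rewrite Ec take_size_cat.
  by rewrite E take_cat ltnNge le /= mem_cat H1.
have Hl : (e', l) \in h1.
  have <- : take (size h1) c = h1 by rewrite E take_size_cat.
  rewrite Ec take_cat ltnNge (ltnW gt) /= mem_cat.
  by case: (size h1 - size g1) (subn_gt0 (size g1) (size h1)) => [|n]; rewrite ?gt //= inE eqxx orbT.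
by have := @wf_before _ h1 h2 e' l i; rewrite -E => /(_ wf Hl H2); rewrite (negPf Ni) andbF.
Qed.

Lemma VFresh_terminates c : (forall s : seq V, exists x, x \notin s) ->
  induced I c -> complete c -> VFresh c ->
  exists k v1 v2, v1 <> v2 /\ may_terminate I (Prg v1 v2 k) 0.
Proof.
move=> inf indc comp [x [d [Hd Hx]]]; have wf := induced_wf indc.
(* The value [y], in the role of v1, differs from [x] and from every value dequeued in [c]. *)
have [y] := inf (x :: pmap (fun a : action V => if a.2 is ResDeq r then r else None) c).
rewrite inE negb_or => /andP[/eqP nyx Hy].
case/splitPr Ec : {1}c / (Hd) => [c1 c2].
have [ey Hey] := event_bound c.
(* In the second case of the violation, [enq_once] would make this enqueue the one preceded by [d],
   although it is invoked before [d] responds. *)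
have no_x e : ~ (e, InvEnq x) \in c1.
  move=> He; have He' : is_enq c e x by rewrite /is_enq Ec mem_cat He.
  case: Hx => [/(_ e)|[e0 [He0 P]]] //.
  have [/(_ _ _ _ He0 He') E _] := indc; rewrite E in P.
  by apply: (@prec_not_before _ _ _ _ _ _ (InvEnq x) wf Ec _ _ He P).
have [|||||k T] := @terminates c1 c2 d ey y x; rewrite -?Ec //.
- move=> l Hl; have /Hey /= : (ey, l) \in c by rewrite Ec mem_cat Hl.
  by rewrite ltnn.
- by move=> g1 e g2 E; case: (no_x e); rewrite E mem_cat inE eqxx orbT.
- move=> e _ He; case/negP: Hy; rewrite mem_pmap.
  by apply/mapP; exists (e, ResDeq (Some y)).
by exists k, y, x.
Qed.

Lemma VOrd_terminates c : induced I c -> complete c -> VOrd c ->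
  exists k v1 v2, v1 <> v2 /\ may_terminate I (Prg v1 v2 k) 0.
Proof.
move=> indc comp [x [y [ey [ex [d [Hey Hex P Hd Hy]]]]]]; have wf := induced_wf indc.
have [once _] := indc.
have nyx : y <> x.
  (* With [y = x], uniqueness of enqueues makes an event precede itself. *)
  move=> E; have E' : ey = ex by apply: once Hey _; rewrite E.
  case: P => h1 [h2 [r [i [Eh R H1 Ni H2]]]]; rewrite E' in H1.
  by have := @wf_before _ h1 h2 ex r i; rewrite -Eh R => /(_ wf H1 H2).
case/splitPr Ec : {1}c / (Hd) => [c1 c2].
have sub a : a \in c1 -> a \in c by rewrite Ec mem_cat => ->.
have Ley l : (ey, l) \in c -> l = InvEnq y \/ l = ResEnq.
  rewrite -mem_labels; case: (wf_enq wf Hey) => ->; rewrite !inE.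
    by move=> /eqP; left.
  by case/orP => /eqP; [left | right].
have [|||||k T] := @terminates c1 c2 d ey y x; rewrite -?Ec //.
- by move=> l /sub /Ley.
(* The only enq(x) is [ex], and [ey] responds before its invocation; [Ley] identifies that response
   as [ResEnq]. *)
- move=> g1 e g2 E.
  have Ee : e = ex by apply: once Hex; apply: sub; rewrite E mem_cat inE eqxx orbT.
  rewrite Ee in E.
  have Eg : c = g1 ++ (ex, InvEnq x) :: (g2 ++ (d, ResDeq (Some x)) :: c2).
    by rewrite Ec E -catA.
  have [r R Hr] := prec_response wf Eg isT P.
  have /Ley[Er|Er] : (ey, r) \in c by rewrite Eg mem_cat Hr.
    by rewrite Er in R.
  by rewrite -Er.
(* Any dequeue of [y] is preceded by [d], hence not invoked in [c1]. *)
- move=> e Hi He; case: Hy => [/(_ e) //|/(_ e He)].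
  by apply: (@prec_not_before _ _ _ _ _ _ InvDeq wf Ec _ _ Hi).
by exists k, y, x.
Qed.

End Completeness.

Theorem theorem6p3 (V : eqType)
  (V_infinite : forall s : seq V, exists x, x \notin s)
  (I : queue_impl V) (I_completable : completable I) :
  (forall c : history V, induced I c -> complete c -> ~ VFresh c /\ ~ VOrd c)
  <->
  (forall (k : nat) (v1 v2 : V), v1 <> v2 ->
     ~ may_terminate I (Prg v1 v2 k) 0).
Proof.
split=> [H k v1 v2 neq T|H c indc comp].
  have [hc [indc comp]] := terminates_violation I_completable neq T.
  by have [] := H _ indc comp => ? ? [].
split=> [/(VFresh_terminates V_infinite indc comp)|/(VOrd_terminates indc comp)];
  by move=> [k [v1 [v2 [neq]]]]; apply: H.
Qed.
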